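(* Let $T$ be a monoidal signature and let $L\xleftarrow{b_1}I\xrightarrow{b_2}R$ be a string graph rewrite rule in $\mathbf{SGraph}_T$. Then any monomorphism $m:L\to G$ in $\mathbf{SGraph}_T$ is an $S$-matching for this rule, where $S:\mathbf{SGraph}_T\to\mathbf{Graph}/G_T$ is the embedding functor.
   Context: $\mathbf{Graph}$ is the category of directed multigraphs $(V,E,s,t)$. A monoidal signature $T=(O,M,\mathrm{dom},\mathrm{cod})$ consists of sets $O,M$ and functions $\mathrm{dom},\mathrm{cod}:M\to w(O)$, where $w(O)$ is the set of finite lists over $O$. The derived typegraph $G_T$ has vertex set $O+M$ and edges: a self-loop $\mathrm{mid}_X$ at each $X\in O$; for $f\in M$ an edge $\mathrm{in}_{f,i}$ from $\mathrm{dom}(f)[i]$ to $f$ for each position $i$ of $\mathrm{dom}(f)$, and an edge $\mathrm{out}_{f,j}$ from $f$ to $\mathrm{cod}(f)[j]$ for each position $j$ of $\mathrm{cod}(f)$. For an object $(G,\tau:G\to G_T)$ of $\mathbf{Graph}/G_T$, a vertex $v$ is a wire-vertex if $\tau(v)\in O$ and a box-vertex if $\tau(v)\in M$; $N(v)=s^{-1}(v)\cup t^{-1}(v)$. $(G,\tau)$ is a string graph if every wire-vertex has at most one in-edge and at most one out-edge, and for each box-vertex $b$ the map $N(b)\to N(\tau(b))$ induced by $\tau$ is a bijection. $\mathbf{SGraph}_T$ is the full subcategory of $\mathbf{Graph}/G_T$ on string graphs, with embedding functor $S$. A wire-vertex with no in-edges is an input, with no out-edges an output, with neither an isolated wire-vertex;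 $\mathrm{In}(G)$, $\mathrm{Out}(G)$ denote the sets of inputs and outputs (also regarded as graphs with no edges). A string graph rewrite rule is a span $L\xleftarrow{b_1}I\xrightarrow{b_2}R$ in $\mathbf{SGraph}_T$ such that $L$ and $R$ contain no isolated wire-vertices, $\mathrm{In}(L)\cong\mathrm{In}(R)$ and $\mathrm{Out}(L)\cong\mathrm{Out}(R)$, $I\cong\mathrm{In}(L)+\mathrm{Out}(L)\cong\mathrm{In}(R)+\mathrm{Out}(R)$ compatibly with these isomorphisms, and $b_1$, $b_2$ are the maps induced by the inclusions of inputs and outputs into $L$ and $R$ respectively. An $S$-pushout is a pushout in $\mathbf{SGraph}_T$ that is preserved by $S$. A monomorphism $m:L\to G$ is an $S$-matching for the rule if $I\xrightarrow{b_1}L\xrightarrow{m}G$ has an $S$-pushout complement, i.e. there are a string graph $G'$ and morphisms $I\to G'\to G$ making the square $I\to L\to G$, $I\to G'\to G$ an $S$-pushout. *)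

(* Defs.v *)
From mathcomp Require Import all_boot.
From mathcomp Require Import boolp classical_sets functions.

Set Implicit Arguments.
Unset Strict Implicit.
Unset Printing Implicit Defensive.

Local Open Scope classical_set_scope.

#[local] Obligation Tactic := idtac.

Declare Scope cat_scope.
Delimit Scope cat_scope with cat.

Record category := Category {
  ob :> Type;
  hom : ob -> ob -> Type;
  idm : forall a, hom a a;
  compm : forall x y z, hom y z -> hom x y -> hom x z;
  comp1m : forall a b (f : hom a b), compm (idm b) f = f;
  compm1 : forall a b (f : hom a b), compm f (idm a) = f;
  compmA : forall a b c d (h : hom c d) (g : hom b c) (f : hom a b),
    compm h (compm g f) = compm (compm h g) f
}.
Arguments hom {C} a b : rename.
Arguments idm {C} a : rename.
Arguments compm {C x y z} g f : rename.

Notation "a ~~> b" := (hom a b) (at level 99, b at level 200) : cat_scope.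
Notation "g \oc f" := (compm g f) (at level 40, left associativity) : cat_scope.
Local Open Scope cat_scope.

Record functor (C D : category) := Functor {
  fob :> C -> D;
  fhom : forall a b : C, (a ~~> b) -> (fob a ~~> fob b);
  fhom1 : forall a, fhom (idm a) = idm (fob a);
  fhomM : forall (a b c : C) (g : b ~~> c) (f : a ~~> b),
    fhom (g \oc f) = fhom g \oc fhom f
}.
Arguments fhom {C D} f {a b} h : rename.

Definition monomorphism (C : category) (a b : C) (m : a ~~> b) : Prop :=
  forall (x : C) (f g : x ~~> a), m \oc f = m \oc g -> f = g.

Definition isomorphism (C : category) (a b : C) (f : a ~~> b) : Prop :=
  exists g : b ~~> a, g \oc f = idm a /\ f \oc g = idm b.

Definition is_coproduct (C : category) (a b c : C)
    (i : a ~~> c) (j : b ~~> c) : Prop :=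
  forall (x : C) (f : a ~~> x) (g : b ~~> x),
    exists! u : c ~~> x, u \oc i = f /\ u \oc j = g.

Definition is_pushout (C : category) (a b c d : C)
    (f : a ~~> b) (g : a ~~> c) (h : b ~~> d) (k : c ~~> d) : Prop :=
  h \oc f = k \oc g /\
  forall (x : C) (p : b ~~> x) (q : c ~~> x), p \oc f = q \oc g ->
    exists! u : d ~~> x, u \oc h = p /\ u \oc k = q.

Definition preserved_pushout (C D : category) (F : functor C D) (a b c d : C)
    (f : a ~~> b) (g : a ~~> c) (h : b ~~> d) (k : c ~~> d) : Prop :=
  is_pushout f g h k /\ is_pushout (fhom F f) (fhom F g) (fhom F h) (fhom F k).

Section Slice.
Variables (C : category) (c : C).

Record slice_ob := SliceOb { slice_dom : C; slice_map : slice_dom ~~> c }.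

Record slice_hom (x y : slice_ob) := SliceHom {
  slice_fun : slice_dom x ~~> slice_dom y;
  slice_comm : slice_map y \oc slice_fun = slice_map x
}.

Lemma slice_hom_eq (x y : slice_ob) (f g : slice_hom x y) :
  slice_fun f = slice_fun g -> f = g.
Proof.
case: f g => [f fP] [g gP] /= fg; move: gP; rewrite -fg => gP.
by rewrite (Prop_irrelevance fP gP).
Qed.

Definition slice_id x : slice_hom x x := SliceHom (compm1 (slice_map x)).

Lemma slice_comp_comm x y z (g : slice_hom y z) (f : slice_hom x y) :
  slice_map z \oc (slice_fun g \oc slice_fun f) = slice_map x.
Proof. by rewrite compmA !slice_comm. Qed.

Definition slice_comp x y z (g : slice_hom y z) (f : slice_hom x y) :
  slice_hom x z := SliceHom (slice_comp_comm g f).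

Program Definition slice : category :=
  @Category slice_ob slice_hom slice_id slice_comp _ _ _.
Next Obligation. by move=> x y f; apply: slice_hom_eq; apply: comp1m. Qed.
Next Obligation. by move=> x y f; apply: slice_hom_eq; apply: compm1. Qed.
Next Obligation. by move=> *; apply: slice_hom_eq; apply: compmA. Qed.

End Slice.

Section FullSubcategory.
Variables (C : category) (P : C -> Prop).

Definition full_subcategory : category :=
  @Category {x : C | P x} (fun x y => sval x ~~> sval y)
    (fun x => idm (sval x)) (fun x y z g f => g \oc f)
    (fun x y f => comp1m f) (fun x y f => compm1 f)
    (fun x y z w h g f => compmA h g f).

Definition full_embedding : functor full_subcategory C :=
  @Functor full_subcategory C sval (fun x y f => f)
    (fun x => erefl) (fun x y z g f => erefl).

End FullSubcategory.

Record graph := Graph {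
  vertex : Type;
  edge : Type;
  source : edge -> vertex;
  target : edge -> vertex
}.
Arguments source {g} e.
Arguments target {g} e.

Record graph_hom (G H : graph) := GraphHom {
  vmap : vertex G -> vertex H;
  emap : edge G -> edge H;
  vmap_source : forall e, vmap (source e) = source (emap e);
  vmap_target : forall e, vmap (target e) = target (emap e)
}.

Lemma graph_hom_eq (G H : graph) (f g : graph_hom G H) :
  vmap f =1 vmap g -> emap f =1 emap g -> f = g.
Proof.
case: f g => [fv fe fs ft] [gv ge gs gt] /= /funext vE /funext eE.
move: gs gt; rewrite -vE -eE => gs gt.
by rewrite (Prop_irrelevance fs gs) (Prop_irrelevance ft gt).
Qed.

Definition graph_id (G : graph) : graph_hom G G :=
  @GraphHom G G id id (fun=> erefl) (fun=> erefl).

Program Definition graph_comp (G H K : graph)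
    (g : graph_hom H K) (f : graph_hom G H) : graph_hom G K :=
  @GraphHom G K (vmap g \o vmap f) (emap g \o emap f) _ _.
Next Obligation. by move=> *; rewrite /= !vmap_source. Qed.
Next Obligation. by move=> *; rewrite /= !vmap_target. Qed.

Program Definition Graphs : category :=
  @Category graph graph_hom graph_id graph_comp _ _ _.
Next Obligation. by move=> *; apply: graph_hom_eq. Qed.
Next Obligation. by move=> *; apply: graph_hom_eq. Qed.
Next Obligation. by move=> *; apply: graph_hom_eq. Qed.

Definition nhd (G : graph) (v : vertex G) : set (edge G) :=
  source @^-1` [set v] `|` target @^-1` [set v].

Record monoidal_signature := MonoidalSignature {
  sig_ob : Type;
  sig_mor : Type;
  sig_dom : sig_mor -> seq sig_ob;
  sig_cod : sig_mor -> seq sig_ob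
}.

Section StringGraphs.
Variable T : monoidal_signature.

Inductive typegraph_edge : Type :=
| mid_edge (X : sig_ob T)
| in_edge (f : sig_mor T) (i : 'I_(size (sig_dom f)))
| out_edge (f : sig_mor T) (j : 'I_(size (sig_cod f))).

Definition typegraph_source (e : typegraph_edge) : sig_ob T + sig_mor T :=
  match e with
  | mid_edge X => inl X
  | in_edge f i => inl (tnth (in_tuple (sig_dom f)) i)
  | out_edge f j => inr f
  end.

Definition typegraph_target (e : typegraph_edge) : sig_ob T + sig_mor T :=
  match e with
  | mid_edge X => inl X
  | in_edge f i => inr f
  | out_edge f j => inl (tnth (in_tuple (sig_cod f)) j)
  end.

Definition typegraph : graph := Graph typegraph_source typegraph_target.

Definition TypedGraphs : category := @slice Graphs typegraph.

Definition carrier (G : TypedGraphs) : graph := slice_dom G.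
Definition typing (G : TypedGraphs) : graph_hom (carrier G) typegraph :=
  slice_map G.

Definition wire_vertex (G : TypedGraphs) (v : vertex (carrier G)) : Prop :=
  exists X : sig_ob T, vmap (typing G) v = inl X.

Definition box_vertex (G : TypedGraphs) (v : vertex (carrier G)) : Prop :=
  exists f : sig_mor T, vmap (typing G) v = inr f.

Definition is_string_graph (G : TypedGraphs) : Prop :=
  (forall v : vertex (carrier G), wire_vertex v ->
     is_subset1 (target @^-1` [set v]) /\
     is_subset1 (source @^-1` [set v])) /\
  (forall b : vertex (carrier G), box_vertex b ->
     set_bij (nhd b) (nhd (vmap (typing G) b)) (emap (typing G))).

Definition SGraph : category := full_subcategory is_string_graph.

Definition S_embedding : functor SGraph TypedGraphs :=
  full_embedding is_string_graph.

Definition is_input (G : TypedGraphs) : set (vertex (carrier G)) :=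
  [set v | wire_vertex v /\ ~ exists e, target e = v].

Definition is_output (G : TypedGraphs) : set (vertex (carrier G)) :=
  [set v | wire_vertex v /\ ~ exists e, source e = v].

Definition no_isolated_wires (G : TypedGraphs) : Prop :=
  ~ exists v : vertex (carrier G), is_input v /\ is_output v.

Section Discrete.
Variables (G : SGraph) (A : set (vertex (carrier (sval G)))).

Definition discrete_graph : graph :=
  @Graph {v | A v} Empty_set
    (fun e => match e with end) (fun e => match e with end).

Definition discrete_incl_graph : graph_hom discrete_graph (carrier (sval G)) :=
  @GraphHom discrete_graph (carrier (sval G)) sval
    (fun e => match e with end)
    (fun e => match e with end) (fun e => match e with end).

Definition discrete_typed : TypedGraphs :=
  @SliceOb Graphs typegraph discrete_graph
    (graph_comp (typing (sval G)) discrete_incl_graph).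

Hypothesis A_wire : forall v, A v -> wire_vertex v.

Lemma discrete_is_string_graph : is_string_graph discrete_typed.
Proof.
split=> [v _|[v Av] [f vf]]; first by split; case.
by have [X vX] := A_wire Av; move: vf; rewrite /= vX.
Qed.

Definition discrete_sgraph : SGraph :=
  exist is_string_graph discrete_typed discrete_is_string_graph.

Definition discrete_incl : discrete_sgraph ~~> G :=
  @SliceHom Graphs typegraph discrete_typed (sval G) discrete_incl_graph erefl.

End Discrete.

Lemma input_wire (G : TypedGraphs) (v : vertex (carrier G)) :
  is_input v -> wire_vertex v.
Proof. by case. Qed.

Lemma output_wire (G : TypedGraphs) (v : vertex (carrier G)) :
  is_output v -> wire_vertex v.
Proof. by case. Qed.

Definition In (G : SGraph) : SGraph :=
  discrete_sgraph (@input_wire (sval G)).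
Definition in_incl (G : SGraph) : In G ~~> G :=
  discrete_incl (@input_wire (sval G)).

Definition Out (G : SGraph) : SGraph :=
  discrete_sgraph (@output_wire (sval G)).
Definition out_incl (G : SGraph) : Out G ~~> G :=
  discrete_incl (@output_wire (sval G)).

(* [iL], [oL] (resp. [iR], [oR]) are the coproduct injections carried along an
   isomorphism of [I] with [In L + Out L] (resp. [In R + Out R]); [al] and [be]
   are the isomorphisms [In L ~ In R] and [Out L ~ Out R], and the two
   descriptions of [I] correspond under [al + be]. *)
Definition is_rewrite_rule (L I R : SGraph)
    (b1 : I ~~> L) (b2 : I ~~> R) : Prop :=
  [/\ no_isolated_wires (sval L), no_isolated_wires (sval R) &
      exists (al : In L ~~> In R) (be : Out L ~~> Out R)
             (iL : In L ~~> I) (oL : Out L ~~> I)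
             (iR : In R ~~> I) (oR : Out R ~~> I),
        [/\ isomorphism al /\ isomorphism be,
            is_coproduct iL oL /\ is_coproduct iR oR,
            iR \oc al = iL /\ oR \oc be = oL,
            b1 \oc iL = in_incl L /\ b1 \oc oL = out_incl L &
            b2 \oc iR = in_incl R /\ b2 \oc oR = out_incl R]].

Definition S_pushout (A B C D : SGraph)
    (f : A ~~> B) (g : A ~~> C) (h : B ~~> D) (k : C ~~> D) : Prop :=
  preserved_pushout S_embedding f g h k.

(* For a rule [L <- I -> R], being a matching only involves its left leg [b1]. *)
Definition is_S_matching (I L : SGraph) (b1 : I ~~> L)
    (G : SGraph) (m : L ~~> G) : Prop :=
  monomorphism m /\
  exists (G' : SGraph) (c : I ~~> G') (d : G' ~~> G), S_pushout b1 c m d.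

End StringGraphs.

(* Main.v *)
(** A monomorphism of string graphs is injective: vertices are separated by
    one-vertex test objects, except boxes of nonzero arity, which are recovered
    from their edges, and edges are determined by their wire ends.  The leg
    [b1] identifies the vertices of [I] with inputs and outputs of [L], so the
    complement is [G] with the edges of [m L] and the interior (non-boundary)
    vertices of [m L] removed.  It is a graph because every edge of [G] at an
    interior vertex comes from [L], and the resulting square is a pushout
    because vertices and edges are glued as sets. *)

Require Import Defs.
From mathcomp Require Import all_boot.
From mathcomp Require Import boolp classical_sets functions.

Set Implicit Arguments.
Unset Strict Implicit.
Unset Printing Implicit Defensive.

Local Open Scope classical_set_scope.
Local Open Scope cat_scope.

(** The existence half of the pushout property for sets. Choice picks at each [d] a value compatible
    with all its preimages: injectivity settles two preimages on the same side, the overlap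
    hypothesis one preimage on each side. *)
Lemma glue_functions (A B C D X : Type) (f : A -> B) (g : A -> C)
    (h : B -> D) (k : C -> D) (p : B -> X) (q : C -> X) :
  injective h -> injective k ->
  (forall d, (exists b, h b = d) \/ (exists c, k c = d)) ->
  (forall b c, h b = k c -> exists2 a, f a = b & g a = c) ->
  p \o f =1 q \o g ->
  exists u : D -> X, u \o h =1 p /\ u \o k =1 q.
Proof.
move=> hI kI cov ov pq.
have [u uP] : {u : D -> X & forall d,
    (forall b, h b = d -> u d = p b) /\ (forall c, k c = d -> u d = q c)}.
  apply: (@choice D X (fun d x =>
    (forall b, h b = d -> x = p b) /\ (forall c, k c = d -> x = q c))) => d.
  case: (cov d) => [[b <-]|[c <-]].
    exists (p b); split=> [b' /hI -> //|c /esym /ov [a <- <-]]; exact: pq.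
  exists (q c); split=> [b /ov [a <- <-]|c' /kI -> //]; exact/esym/pq.
exists u; split=> [b|c] /=; first by have [+ _] := uP (h b); apply.
by have [_ +] := uP (k c); apply.
Qed.

(** * Typed graphs: morphisms and a pushout criterion *)

Section TypedHom.
Variable T : monoidal_signature.
Implicit Types X Y Z : TypedGraphs T.

Definition vm X Y (f : X ~~> Y) : vertex (carrier X) -> vertex (carrier Y) :=
  vmap (slice_fun f).

Definition em X Y (f : X ~~> Y) : edge (carrier X) -> edge (carrier Y) :=
  emap (slice_fun f).

Lemma vm_source X Y (f : X ~~> Y) e : vm f (source e) = source (em f e).
Proof. exact: vmap_source. Qed.

Lemma vm_target X Y (f : X ~~> Y) e : vm f (target e) = target (em f e).
Proof. exact: vmap_target. Qed.

Lemma typing_vm X Y (f : X ~~> Y) v :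
  vmap (typing Y) (vm f v) = vmap (typing X) v.
Proof. by have := slice_comm f => /(congr1 (fun h => vmap h v)). Qed.

Lemma typing_em X Y (f : X ~~> Y) e :
  emap (typing Y) (em f e) = emap (typing X) e.
Proof. by have := slice_comm f => /(congr1 (fun h => emap h e)). Qed.

Lemma wire_vm X Y (f : X ~~> Y) v : wire_vertex v -> wire_vertex (vm f v).
Proof. by case=> O vO; exists O; rewrite typing_vm. Qed.

Lemma box_vm X Y (f : X ~~> Y) v : box_vertex v -> box_vertex (vm f v).
Proof. by case=> F vF; exists F; rewrite typing_vm. Qed.

Lemma nhd_em X Y (f : X ~~> Y) v e : nhd v e -> nhd (vm f v) (em f e).
Proof.
by case=> <-; [left|right]; rewrite /= -?vm_source -?vm_target.
Qed.

Lemma typed_hom_eq X Y (f g : X ~~> Y) :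
  vm f =1 vm g -> em f =1 em g -> f = g.
Proof. by move=> vE eE; apply/slice_hom_eq/graph_hom_eq. Qed.

(** The result is specified only by its two underlying maps, so later proofs need not unfold the
    slice construction. *)
Lemma typed_hom_build X Y (fv : vertex (carrier X) -> vertex (carrier Y))
    (fe : edge (carrier X) -> edge (carrier Y)) :
  (forall e, fv (source e) = source (fe e)) ->
  (forall e, fv (target e) = target (fe e)) ->
  (forall v, vmap (typing Y) (fv v) = vmap (typing X) v) ->
  (forall e, emap (typing Y) (fe e) = emap (typing X) e) ->
  {f : X ~~> Y | vm f =1 fv /\ em f =1 fe}.
Proof.
move=> fs ft fvT feT.
have fT : slice_map Y \oc (GraphHom fs ft : slice_dom X ~~> slice_dom Y)
    = slice_map X by apply: graph_hom_eq.
by exists (SliceHom fT).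
Qed.

(** Vertices and edges are glued separately as sets. Joint surjectivity of [h] and [k] makes the two
    mediating maps compatible with sources, targets and typing, and also makes them unique. *)
Lemma typed_pushout A B C D (f : A ~~> B) (g : A ~~> C) (h : B ~~> D)
    (k : C ~~> D) :
  h \oc f = k \oc g ->
  injective (vm h) -> injective (vm k) ->
  (forall d, (exists b, vm h b = d) \/ (exists c, vm k c = d)) ->
  (forall b c, vm h b = vm k c -> exists2 a, vm f a = b & vm g a = c) ->
  injective (em h) -> injective (em k) ->
  (forall d, (exists b, em h b = d) \/ (exists c, em k c = d)) ->
  (forall b c, em h b = em k c -> exists2 a, em f a = b & em g a = c) ->
  is_pushout f g h k.
Proof.
move=> sq hvI kvI covv ovv heI keI cove ove; split=> // X p q pq.
have pqv : vm p \o vm f =1 vm q \o vm g.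
  by move=> v; have := congr1 (fun r : A ~~> X => vm r v) pq.
have pqe : em p \o em f =1 em q \o em g.
  by move=> e; have := congr1 (fun r : A ~~> X => em r e) pq.
have [uv [uvh uvk]] := glue_functions hvI kvI covv ovv pqv.
have [ue [ueh uek]] := glue_functions heI keI cove ove pqe.
have uvh' b : uv (vm h b) = vm p b by exact: uvh.
have uvk' b : uv (vm k b) = vm q b by exact: uvk.
have ueh' b : ue (em h b) = em p b by exact: ueh.
have uek' b : ue (em k b) = em q b by exact: uek.
have [| | | |u [uV uE]] := @typed_hom_build D X uv ue.
- by move=> d; case: (cove d) => -[e <-];
    rewrite -vm_source ?uvh' ?uvk' ?ueh' ?uek' vm_source.
- by move=> d; case: (cove d) => -[e <-];
    rewrite -vm_target ?uvh' ?uvk' ?ueh' ?uek' vm_target.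
- by move=> d; case: (covv d) => -[v <-]; rewrite ?uvh' ?uvk' !typing_vm.
- by move=> d; case: (cove d) => -[e <-]; rewrite ?ueh' ?uek' !typing_em.
exists u; split.
  by split; apply: typed_hom_eq => x;
    rewrite -?uvh' -?uvk' -?ueh' -?uek' -?uV -?uE.
move=> u' [u'h u'k]; apply: typed_hom_eq => d.
  rewrite uV; case: (covv d) => -[x <-].
    by rewrite uvh' -u'h.
  by rewrite uvk' -u'k.
rewrite uE; case: (cove d) => -[x <-].
  by rewrite ueh' -u'h.
by rewrite uek' -u'k.
Qed.

Lemma wire_or_box X (v : vertex (carrier X)) : wire_vertex v \/ box_vertex v.
Proof.
by case E: (vmap (typing X) v) => [O|F]; [left; exists O|right; exists F].
Qed.

Lemma wireNbox X (v : vertex (carrier X)) : wire_vertex v -> ~ box_vertex v.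
Proof. by move=> [O vO] [F]; rewrite vO. Qed.

(** No edge of the typegraph joins two boxes. *)
Lemma wire_end X (e : edge (carrier X)) :
  wire_vertex (source e) \/ wire_vertex (target e).
Proof.
case E: (emap (typing X) e) => [O|F i|F j].
- by left; exists O; rewrite vmap_source E.
- by left; eexists; rewrite vmap_source E.
- by right; eexists; rewrite vmap_target E.
Qed.

End TypedHom.

(** * Subgraphs of typed graphs *)

Section Subgraph.
Variables (T : monoidal_signature) (G : TypedGraphs T).
Variables (P : set (vertex (carrier G))) (Q : set (edge (carrier G))).
Hypothesis Q_source : forall e, Q e -> P (source e).
Hypothesis Q_target : forall e, Q e -> P (target e).

Definition subgraph : graph :=
  @Graph {v | P v} {e | Q e} (fun e => exist P _ (Q_source (svalP e)))
    (fun e => exist P _ (Q_target (svalP e))).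

Definition subgraph_incl : graph_hom subgraph (carrier G) :=
  @GraphHom subgraph (carrier G) sval sval (fun=> erefl) (fun=> erefl).

Definition typed_subgraph : TypedGraphs T :=
  @SliceOb Graphs (typegraph T) subgraph
    (graph_comp (typing G) subgraph_incl).

Definition typed_subgraph_incl : typed_subgraph ~~> G :=
  @SliceHom Graphs (typegraph T) typed_subgraph G subgraph_incl erefl.

(** Passing to a subgraph can only lower the degree of a wire, so the condition to secure is that
    each remaining box keeps its whole neighbourhood. *)
Lemma subgraph_string : is_string_graph G ->
  (forall v e, P v -> box_vertex v -> nhd v e -> Q e) ->
  is_string_graph typed_subgraph.
Proof.
move=> [wG bG] PQ; split=> [v wv|[v Pv] bv].
  have [wt ws] := wG (sval v) wv.
  by split=> -[e Qe] [e' Qe'] eE e'E; apply: eq_exist; [apply: wt|apply: ws];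
    first [exact: (congr1 sval eE)|exact: (congr1 sval e'E)].
have [gF gI gS] := bG v bv.
have nE (e : edge subgraph) :
    nhd (exist P v Pv : vertex subgraph) e <-> nhd v (sval e).
  by split=> -[E|E]; [left|right|left|right];
    [exact: (congr1 sval E)|exact: (congr1 sval E)|exact: eq_exist|exact: eq_exist].
split.
- by move=> e /nE; apply: gF.
- move=> [e Qe] [e' Qe'] /set_mem/nE ne /set_mem/nE ne' E.
  by apply: eq_exist; apply: gI => //; apply/mem_set.
- move=> e /gS [e' ne' <-].
  by exists (exist Q e' (PQ _ _ Pv bv ne')) => //; apply/nE.
Qed.

End Subgraph.

(** * Injectivity of monomorphisms *)

Section Mono.
Variables (T : monoidal_signature) (L G : SGraph T) (m : L ~~> G).
Hypothesis mono_m : monomorphism m.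

(* The test object is a single vertex, which is a string graph unless it is
   a box of nonzero arity. *)
Lemma mono_inj_point v w :
  (box_vertex v -> ~ exists e, nhd (vmap (typing (sval L)) v) e) ->
  vm m v = vm m w -> v = w.
Proof.
move=> arity0 mvw.
pose D := @discrete_typed T L [set v].
have Dstr : is_string_graph D.
  split=> [x _|[x xv] bx]; first by split; case.
  have no_e : ~ exists e, nhd (vmap (typing (sval L)) x) e.
    by rewrite xv; apply: arity0; case: bx => F xF; exists F; rewrite -xv.
  by split=> [[]|[]|e ne]; case: no_e; exists e.
pose D' : SGraph T := exist _ D Dstr.
have [| | | |f [fV _]] := @typed_hom_build T D (sval L) sval
  (fun e => match e with end); try by case.
have [| | | |g [gV _]] := @typed_hom_build T D (sval L) (fun=> w)
  (fun e => match e with end); try by case.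
  by move=> [x xv] /=; rewrite -(typing_vm m) -mvw typing_vm -xv.
have fg : (f : D' ~~> L) = g.
  apply: mono_m; apply: (@typed_hom_eq T D) => [[x xv]|[]].
  rewrite -[LHS]/(vm m (vm f (exist _ x xv))) fV.
  by rewrite -[RHS]/(vm m (vm g (exist _ x xv))) gV /= -mvw xv.
have /= := gV (exist _ v erefl); rewrite -fg => <-.
by rewrite fV.
Qed.

Lemma mono_inj_wire v w : wire_vertex v -> vm m v = vm m w -> v = w.
Proof. by move=> wv; apply: mono_inj_point => /(wireNbox wv). Qed.

(** Two edges with the same image share their wire end, by injectivity on wires, and a wire has at
    most one edge in each direction. *)
Lemma mono_inj_edge : injective (em m).
Proof.
move=> e e' mee'; have [wL _] := svalP L.
have [we|we] := wire_end e.
  apply: (wL _ we).2 => //=; apply/esym/(mono_inj_wire we).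
  by rewrite !vm_source mee'.
apply: (wL _ we).1 => //=; apply/esym/(mono_inj_wire we).
by rewrite !vm_target mee'.
Qed.

Lemma mono_inj_vertex : injective (vm m).
Proof.
move=> v w mvw.
(* What remains beyond [mono_inj_point] is a box with some edge [e] at its type. The plan is to
   compare the edges of [v] and [w] lying over [e]. *)
have [[bv [e ne]]|] := pselect
  (box_vertex v /\ exists e, nhd (vmap (typing (sval L)) v) e); last first.
  by move=> no_e; apply: mono_inj_point mvw => bv ex; apply: no_e.
have tvw : vmap (typing (sval L)) w = vmap (typing (sval L)) v.
  by rewrite -(typing_vm m) -mvw typing_vm.
have bw : box_vertex w by case: bv => F vF; exists F; rewrite tvw.
have [_ bL] := svalP L; have [_ bG] := svalP G.
have [_ _ /(_ e ne) [ev nev evE]] := bL _ bv.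
have [_ _ + ] := bL _ bw; rewrite tvw => /(_ e ne) [ew new ewE].
(* Both images are edges over [e] at the one box [vm m v], where typing is injective. *)
have evw : ev = ew.
  apply: mono_inj_edge; have [_ inj _] := bG _ (box_vm m bv).
  apply: inj; [| |by rewrite !typing_em evE ewE]; apply/mem_set.
    exact: nhd_em.
  by rewrite mvw; apply: nhd_em.
move: new; rewrite -evw => new.
(* One end of [ev] is a wire, so the boxes [v] and [w] must both be the other end. *)
have [we|we] := wire_end ev.
- case: nev => [E|<-]; first by case: (wireNbox we); rewrite E.
  by case: new => // E; case: (wireNbox we); rewrite E.
- case: nev => [<-|E]; last by case: (wireNbox we); rewrite E.
  by case: new => // E; case: (wireNbox we); rewrite E.
Qed.

End Mono.

(** * The boundary of [L] and the interface of a rule *)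

Definition boundary (T : monoidal_signature) (L : TypedGraphs T) :
    set (vertex (carrier L)) :=
  [set v | is_input v \/ is_output v].

Lemma boundary_wire (T : monoidal_signature) (L : TypedGraphs T)
  (v : vertex (carrier L)) : boundary v -> wire_vertex v.
Proof. by case; case. Qed.

Section Interface.
Variables (T : monoidal_signature) (L I : SGraph T) (b : I ~~> L).
Variables (i : In L ~~> I) (o : Out L ~~> I).
Hypothesis coprod : is_coproduct i o.
Hypothesis bi : b \oc i = in_incl L.
Hypothesis bo : b \oc o = out_incl L.

Lemma boundary_interface v : boundary v -> exists x, vm b x = v.
Proof.
case=> v_bd.
  exists (vm i (exist _ v v_bd)).
  exact: (congr1 (fun r : In L ~~> L => vm r (exist _ v v_bd)) bi).
exists (vm o (exist _ v v_bd)).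
exact: (congr1 (fun r : Out L ~~> L => vm r (exist _ v v_bd)) bo).
Qed.

(** [I] is known only through a universal property. Mapping it to the discrete graph on the boundary
    shows both that it has no edges and that [b] lands in the boundary. *)
Lemma interface_factor :
  exists u : I ~~> discrete_sgraph (@boundary_wire T (sval L)),
    discrete_incl (@boundary_wire T (sval L)) \oc u = b.
Proof.
set D := discrete_sgraph _; set inc := discrete_incl _.
have [| | | |f [fV _]] := @typed_hom_build T (sval (In L)) (sval D)
  (fun x => exist _ (sval x) (or_introl (svalP x)))
  (fun e => match e with end); try by case.
have [| | | |g [gV _]] := @typed_hom_build T (sval (Out L)) (sval D)
  (fun x => exist _ (sval x) (or_intror (svalP x)))
  (fun e => match e with end); try by case.
have [u [[ui uo] _]] := coprod f g.
exists u.
(* Both [b] and the composite through [D] mediate the two inclusions, so uniqueness identifies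
   them. *)
have [w [_ wU]] := coprod (in_incl L) (out_incl L).
rewrite -(wU b) //; symmetry; apply: wU; rewrite -!compmA ui uo; split.
  apply: (@typed_hom_eq T (sval (In L))) => [x|[]].
  by rewrite -[LHS]/(vm inc (vm f x)) fV.
apply: (@typed_hom_eq T (sval (Out L))) => [x|[]].
by rewrite -[LHS]/(vm inc (vm g x)) gV.
Qed.

Lemma interface_boundary x : boundary (vm b x).
Proof. by have [u <-] := interface_factor; exact: (svalP (vm u x)). Qed.

Lemma interface_discrete : edge (carrier (sval I)) -> False.
Proof. by have [u _] := interface_factor; move=> e; case: (em u e). Qed.

End Interface.

(** * The pushout complement *)

Section Complement.
Variables (T : monoidal_signature) (L G : SGraph T) (m : L ~~> G).

(** Vertices outside the image of [m] qualify vacuously; only images of interior vertices are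
    excluded. *)
Definition outside_vertex : set (vertex (carrier (sval G))) :=
  [set v | forall l, vm m l = v -> boundary l].

Definition outside_edge : set (edge (carrier (sval G))) :=
  [set e | ~ exists l, em m l = e].

(* Interior wires already have their in- and out-edge in [L], and boxes their
   whole neighbourhood, so [G] adds no edge at an interior vertex of [L]. *)
Lemma outside_edge_nhd v e : outside_edge e -> nhd v e -> outside_vertex v.
Proof.
move=> oe nve l lv; subst v; have [wL bL] := svalP L; have [wG bG] := svalP G.
have [wl|bl] := wire_or_box l; last first.
  have [F inj _] := bG _ (box_vm m bl).
  have [_ _ surj] := bL _ bl.
  have := F e nve; rewrite typing_vm => /surj [e' ne' e'E].
  case: oe; exists e'; apply: inj; rewrite ?typing_em //; apply/mem_set => //.
  exact: nhd_em.
apply: contrapT => nbd; apply: oe.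
have [wt ws] := wG _ (wire_vm m wl).
case: nve => E.
  have [e' e'l] : exists e', source e' = l.
    by apply: contrapT => no; apply: nbd; right.
  by exists e'; apply: ws => //=; rewrite -vm_source e'l.
have [e' e'l] : exists e', target e' = l.
  by apply: contrapT => no; apply: nbd; left.
by exists e'; apply: wt => //=; rewrite -vm_target e'l.
Qed.

Lemma outside_source e : outside_edge e -> outside_vertex (source e).
Proof. by move=> oe; apply: outside_edge_nhd oe _; left. Qed.

Lemma outside_target e : outside_edge e -> outside_vertex (target e).
Proof. by move=> oe; apply: outside_edge_nhd oe _; right. Qed.

(** A box that survives is not in the image of [m], since its preimages would be boundary wires.
    Hence none of its edges comes from [L], and all of them survive. *)
Lemma complement_string :
  is_string_graph (typed_subgraph outside_source outside_target).
Proof.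
apply: subgraph_string; first exact: svalP.
move=> v e ov bv nve [l le].
have notbd x : vm m x <> v.
  move=> xv; apply: (@wireNbox T _ v) => //.
  by rewrite -xv; apply/wire_vm/boundary_wire/ov.
case: nve => E; [apply: (notbd (source l))|apply: (notbd (target l))].
  by rewrite vm_source le.
by rewrite vm_target le.
Qed.

Definition complement : SGraph T := exist _ _ complement_string.

Definition complement_incl : complement ~~> G :=
  typed_subgraph_incl outside_source outside_target.

End Complement.

Theorem theorem5p2p3 (T : monoidal_signature) (L I R : SGraph T)
    (b1 : I ~~> L) (b2 : I ~~> R) (rule : is_rewrite_rule b1 b2)
    (G : SGraph T) (m : L ~~> G) (mono_m : monomorphism m) :
  is_S_matching b1 m.
Proof.
split=> //.
case: rule => _ _ [_ [_ [i [o [_ [_ [_ [coprod _] _ [bi bo] _]]]]]]].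
have bdI := interface_boundary coprod bi bo.
have Idisc := interface_discrete coprod bi bo.
have mV := mono_inj_vertex mono_m; have mE := mono_inj_edge mono_m.
(* By injectivity, [vm b1 x] is the only preimage to check, and it lies on the boundary. *)
have out_b x : outside_vertex m (vm m (vm b1 x)) by move=> l /mV ->.
have [| | | |c [cV _]] := @typed_hom_build T (sval I) (sval (complement m))
  (fun x => exist _ _ (out_b x)) (fun e => match Idisc e with end);
  try by move=> e; case: (Idisc e).
  by move=> x; rewrite -(typing_vm b1) -(typing_vm m).
exists (complement m), c, (complement_incl m).
have po : @is_pushout (TypedGraphs T) _ _ _ _ b1 c m (complement_incl m).
  apply: typed_pushout => //.
  - apply: typed_hom_eq => [x|e]; last by case: (Idisc e).
    by rewrite -[RHS]/(vm (complement_incl m) (vm c x)) cV.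
  - by move=> [x Px] [y Py]; apply: eq_exist.
  - move=> v; have [ov|nov] := pselect (outside_vertex m v).
      by right; exists (exist _ v ov).
    by left; apply: contrapT => no; apply: nov => l lv; case: no; exists l.
  (* The overlap of [L] and the complement on vertices is the boundary, which [I] covers. *)
  - move=> l [v ov] lv; have [x xl] := boundary_interface bi bo (ov l lv).
    by exists x => //; rewrite cV; apply: eq_exist; rewrite xl.
  - by move=> [x Px] [y Py]; apply: eq_exist.
  - move=> e; have [ie|oe] := pselect (exists l, em m l = e); first by left.
    by right; exists (exist _ e oe).
  (* On edges the overlap is empty, as is the edge set of [I]. *)
  - by move=> l e le; case: (svalP e); exists l.
(* By fullness, the universal property among typed graphs restricts to string graphs. *)
by split=> //; split; [case: po|move=> X; case: po => _; apply].
Qed.
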